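(* Let $(X,\rho)$ be a complete metric space and let $\mathcal{K}\subset C(\mathbb{R}^+,X)$ satisfy (K1)–(K4) (listed in the context). Let $\varphi\in\mathcal{K}$ be such that the closure of its positive orbit $\bigcup_{t\ge0}\{\varphi(t)\}$ is compact, and let $M\subset X$ be a compact, isolated, quasi-invariant set. If $\omega(\varphi)\cap M\ne\varnothing$ but $\omega(\varphi)\not\subset M$, then $$\omega(\varphi)\cap\{W^s_w(M)\setminus M\}\ne\varnothing,\qquad \omega(\varphi)\cap\{W^u(M)\setminus M\}\ne\varnothing.$$ Moreover, there are $x\in\omega(\varphi)\cap\{W^s_w(M)\setminus M\}$ and a function $\phi\in\mathcal{K}$ as in the definition of $W^s_w(M)$ (i.e. $\phi(0)=x$, $\varnothing\ne\omega(\phi)\subset M$) such that $\phi(t)\in\omega(\varphi)\cup M$ for all $t\ge0$; and there are $x'\in\omega(\varphi)\cap\{W^u(M)\setminus M\}$ and a complete trajectory $\phi'$ as in the definition of $W^u(M)$ (i.e. $\phi'(0)=x'$, $\varnothing\ne\alpha(\phi')\subset M$) such that $\phi'(t)\in\omega(\varphi)\cup M$ for all $t\in\mathbb{R}$.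
   Context: $\mathbb{R}^+=[0,\infty)$. Conditions on $\mathcal{K}\subset C(\mathbb{R}^+,X)$: (K1) for every $x\in X$ there is $\varphi\in\mathcal{K}$ with $\varphi(0)=x$; (K2) if $\varphi\in\mathcal{K}$ and $\tau\ge 0$, then $\varphi(\cdot+\tau)\in\mathcal{K}$; (K3) if $\varphi_1,\varphi_2\in\mathcal{K}$ and $\varphi_2(0)=\varphi_1(s)$ with $s>0$, then the function equal to $\varphi_1(t)$ for $t\le s$ and to $\varphi_2(t-s)$ for $t>s$ belongs to $\mathcal{K}$; (K4) if $\varphi_n\in\mathcal{K}$ and $\varphi_n(0)\to x_0\in X$, then there are a subsequence and $\varphi_0\in\mathcal{K}$ with $\varphi_{n_k}(t)\to\varphi_0(t)$ uniformly on compact subsets of $[0,\infty)$. A map $\phi:\mathbb{R}\to X$ is a complete trajectory of $\mathcal{K}$ if $\phi(\cdot+h)|_{[0,\infty)}\in\mathcal{K}$ for all $h\in\mathbb{R}$; $\mathcal{F}$ denotes the set of all complete trajectories. A set $A\subset X$ is quasi-invariant if for each $x\in A$ there is $\phi\in\mathcal{F}$ with $\phi(0)=x$ and $\phi(t)\in A$ for all $t\in\mathbb{R}$. A quasi-invariant set $M$ is isolated if there is a neighborhood $O$ of $M$ such that $M$ is the maximal quasi-invariant set in $O$. For $\varphi\in\mathcal{K}$, $\omega(\varphi)=\{y\in X:\exists\,t_n\to+\infty\text{ with }\varphi(t_n)\to y\}$; for $\phi\in\mathcal{F}$, $\alpha(\phi)=\{y\in X:\exists\,t_n\to-\infty\text{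 with }\phi(t_n)\to y\}$. For an isolated quasi-invariant set $M$, the weakly stable set is $W^s_w(M)=\{x\in X:\exists\,\phi\in\mathcal{K}\text{ with }\phi(0)=x,\ \omega(\phi)\neq\varnothing,\ \omega(\phi)\subset M\}$ and the unstable set is $W^u(M)=\{x\in X:\exists\,\phi\in\mathcal{F}\text{ with }\phi(0)=x,\ \alpha(\phi)\ne\varnothing,\ \alpha(\phi)\subset M\}$. *)

(* Defs.v *)
From HB Require Import structures.
From mathcomp Require Import all_boot all_order all_algebra.
From mathcomp Require Import all_classical all_reals all_analysis.

Set Implicit Arguments.
Unset Strict Implicit.
Unset Printing Implicit Defensive.

Import Order.TTheory GRing.Theory Num.Theory.
Import numFieldNormedType.Exports.

Local Open Scope classical_set_scope.
Local Open Scope ring_scope.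

(* The half-line [0, +oo) as a type of its own, with the subset topology: the
   sort [set_type] of a set carries the initial topology of its inclusion. *)
Definition half_line (R : realType) : set R := `[0, +oo[%classic.
Arguments half_line : clear implicits.

Notation Rplus R := (set_type (half_line R)).

Section half_line_operations.
Context {R : realType}.

Fact nneg_subproof (x : R) : Num.max 0 x \in half_line R.
Proof. by rewrite /half_line mem_setE in_itv /= andbT le_max lexx. Qed.

(* The point x of the half-line, when 0 <= x; negative reals are sent to 0,
   but the definitions below only use [nneg] at nonnegative reals. *)
Definition nneg (x : R) : Rplus R := exist _ (Num.max 0 x) (nneg_subproof x).

Lemma val_nneg (x : R) : 0 <= x -> \val (nneg x) = x.
Proof. by move=> x0; rewrite /= max_r. Qed.

Lemma Rplus_ge0 (t : Rplus R) : 0 <= \val t.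
Proof. by case: t => x /=; rewrite /half_line mem_setE in_itv /= andbT. Qed.

Lemma nnegK (t : Rplus R) : nneg (\val t) = t.
Proof. by apply: val_inj; rewrite val_nneg// Rplus_ge0. Qed.

Definition translate {T : Type} (tau : Rplus R) (f : Rplus R -> T) :
    Rplus R -> T :=
  fun t => f (nneg (\val t + \val tau)).

Definition concat {T : Type} (s : Rplus R) (f1 f2 : Rplus R -> T) :
    Rplus R -> T :=
  fun t => if \val t <= \val s then f1 t else f2 (nneg (\val t - \val s)).

End half_line_operations.

Definition complete_space (R : realType) (X : metricType R) : Prop :=
  forall u : nat -> X, cauchy (u @ \oo) -> exists l : X, u @ \oo --> l.

Section trajectories.
Context {R : realType} {X : metricType R}.
Implicit Types (K : set (Rplus R -> X)) (A M O : set X).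

Definition K1 K : Prop := forall x : X, exists2 phi, K phi & phi (nneg 0) = x.

Definition K2 K : Prop :=
  forall (phi : Rplus R -> X) (tau : Rplus R), K phi -> K (translate tau phi).

Definition K3 K : Prop :=
  forall (phi1 phi2 : Rplus R -> X) (s : Rplus R), K phi1 -> K phi2 ->
    0 < \val s -> phi2 (nneg 0) = phi1 s -> K (concat s phi1 phi2).

Definition K4 K : Prop :=
  forall (phi : nat -> Rplus R -> X) (x0 : X), (forall n, K (phi n)) ->
    phi n (nneg 0) @[n --> \oo] --> x0 ->
    exists (sigma : nat -> nat) (phi0 : Rplus R -> X),
      [/\ increasing_seq sigma, K phi0 &
          forall C : set (Rplus R), compact C ->
            {uniform C, (fun k => phi (sigma k)) @ \oo --> phi0}].

(* [sigL A f] is the restriction of f to the subtype of A. *)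
Definition complete_trajectory K (phi : R -> X) : Prop :=
  forall h : R, K (sigL (half_line R) (fun t => phi (t + h))).

Definition quasi_invariant K A : Prop :=
  forall x, A x -> exists phi : R -> X,
    [/\ complete_trajectory K phi, phi 0 = x & forall t, A (phi t)].

(* "Maximal" is with respect to inclusion: M contains every quasi-invariant
   subset of O. *)
Definition maximal_quasi_invariant_in K O M : Prop :=
  [/\ quasi_invariant K M, M `<=` O &
      forall A, quasi_invariant K A -> A `<=` O -> A `<=` M].

Definition isolated_quasi_invariant K M : Prop :=
  exists2 O, set_nbhs M O & maximal_quasi_invariant_in K O M.

Definition omega (phi : Rplus R -> X) : set X :=
  [set y | exists2 t : nat -> Rplus R,
     \val (t n) @[n --> \oo] --> +oo & phi (t n) @[n --> \oo] --> y].

Definition alpha (phi : R -> X) : set X :=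
  [set y | exists2 t : nat -> R,
     t n @[n --> \oo] --> -oo & phi (t n) @[n --> \oo] --> y].

Definition weakly_stable_witness K M (x : X) (phi : Rplus R -> X) : Prop :=
  [/\ K phi, phi (nneg 0) = x, omega phi !=set0 & omega phi `<=` M].

Definition weakly_stable_set K M : set X :=
  [set x | exists phi, weakly_stable_witness K M x phi].

Definition unstable_witness K M (x : X) (phi : R -> X) : Prop :=
  [/\ complete_trajectory K phi, phi 0 = x, alpha phi !=set0 &
      alpha phi `<=` M].

Definition unstable_set K M : set X :=
  [set x | exists phi, unstable_witness K M x phi].

End trajectories.

(* Main.v *)
Require Import Defs.
From HB Require Import structures.
From mathcomp Require Import all_boot all_order all_algebra.
From mathcomp Require Import all_classical all_reals all_analysis.
Import Order.TTheory GRing.Theory Num.Theory.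
Import numFieldNormedType.Exports.
Local Open Scope classical_set_scope.
Local Open Scope ring_scope.

(* The idea is to look at [phi] near [M] along an ultrafilter on nat refining
   [\oo]: compactness gives pointwise limits of all the translates
   [phi (s n + t)], and (K4) makes these limits complete trajectories. Let U be
   an open neighbourhood of M whose closure lies in an isolating neighbourhood
   and misses some point of [omega phi]. Then [phi] keeps coming close to a
   point y of [omega phi `&` M] at times t_n and keeps leaving U. For the
   unstable set let s_n be the first exit time from U after t_n. If
   s_n - t_n --> +oo, the limit of the translates by s_n starts outside U and
   stays in the closure of U in the past, so its alpha-limit set is
   quasi-invariant, hence inside M by maximality. If s_n - t_n converges, the
   limit of the translates by t_n starts at y and leaves U in finite time, and
   (K3) glues it to a complete trajectory through y inside M. The weakly stable
   set is obtained symmetrically, from the last time s_n outside U before t_n.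
*)

Set Implicit Arguments.
Unset Strict Implicit.
Unset Printing Implicit Defensive.

(** * The half-line, and convergence of sequences *)

Lemma nneg_continuous (R : realType) : continuous (@nneg R).
Proof.
apply: continuous_comp_initial => x.
by apply: (@continuous_max _ _ (cst 0) id); [exact: cvg_cst|exact: cvg_id].
Qed.

Lemma val_continuous (R : realType) :
  continuous (fun t : Rplus R => \val t : R).
Proof. exact: initial_continuous. Qed.

(** Composing with [nneg] gives continuous functions on all of R, so the usual density of the
    rationals applies; negative rationals are harmless, being sent to 0. *)
Lemma continuous_eq_nneg_rat (R : realType) (X : metricType R)
    (f g : Rplus R -> X) :
  continuous f -> continuous g ->
  (forall q : rat, f (nneg (ratr q)) = g (nneg (ratr q))) -> f = g.
Proof.
move=> cf cg fg; apply/funext => t; apply: contrapT => /eqP fgt.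
have := @metric_hausdorff R X; rewrite open_hausdorff.
move=> /(_ _ _ fgt)[[A B]/= [/set_mem ft /set_mem gt] [oA oB AB0]].
pose O := [set x : R | A (f (nneg x))] `&` [set x : R | B (g (nneg x))].
have cfn : continuous (fun x : R => f (nneg x)).
  by move=> x; apply: continuous_comp; [exact: nneg_continuous|exact: cf].
have cgn : continuous (fun x : R => g (nneg x)).
  by move=> x; apply: continuous_comp; [exact: nneg_continuous|exact: cg].
have oO : open O.
  by apply: openI; [move/continuousP: cfn => /(_ A oA)|
                    move/continuousP: cgn => /(_ B oB)].
have [|x [[Ax Bx] [q _ qx]]] := @dense_rat R O _ oO.
  by exists (\val t); rewrite /O /= nnegK.
have : (A `&` B) (f (nneg x)) by split=> //; rewrite -qx fg qx.
by move/eqP: AB0 => ->.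
Qed.

Lemma cvg_subseq (X : topologicalType) (u : nat -> X) (sigma : nat -> nat)
    (y : X) :
  increasing_seq sigma -> u k @[k --> \oo] --> y ->
  u (sigma k) @[k --> \oo] --> y.
Proof.
move=> incr uy; have ge n : (n <= sigma n)%N.
  elim: n => // n IH; apply: leq_ltn_trans IH _.
  by have := leW_mono incr n n.+1; rewrite ltEnat /= ltnSn => ->.
apply: (@cvg_comp _ _ _ sigma u _ \oo) => // A [N _ NA].
by exists N => //= n Nn; apply: NA; exact: leq_trans Nn (ge n).
Qed.

Lemma cvg_ball_inv (R : realType) (X : pseudoMetricType R) (u : nat -> X)
    (y : X) :
  (forall k, ball y k.+1%:R^-1 (u k)) -> u @ \oo --> y.
Proof.
move=> uy; apply/cvg_ballP => e e0; near=> k.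
apply: le_ball (uy k); apply/ltW; near: k.
exact: near_infty_natSinv_lt (PosNum e0).
Unshelve. all: by end_near. Qed.

(** * Pointwise limits of trajectories along a filter *)

Section limits_of_trajectories.
Context {R : realType} {X : metricType R} (K : set (Rplus R -> X)).
Hypothesis KC : forall f, K f -> continuous f.
Hypothesis hK4 : K4 K.

Section pointwise.
Context {I : Type} (F : set_system I) {FF : ProperFilter F}.
Variables (f : I -> Rplus R -> X) (phi : Rplus R -> X).
Hypothesis Kf : \forall i \near F, K (f i).
Hypothesis f_cvg : forall t, f i t @[i --> F] --> phi t.

(** (K4) concerns sequences while [F] is arbitrary, so a sequence of indices is chosen diagonally,
    the k-th one being good at the rational points numbered up to k. The family [G] lets the caller
    impose countably many further conditions on it. *)
Lemma K4_extraction (G : nat -> set I) : (forall k, F (G k)) ->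
  exists (i : nat -> I) (sigma : nat -> nat) (phi0 : Rplus R -> X),
    [/\ forall k, G k (i k), increasing_seq sigma, K phi0,
        forall q : rat, phi0 (nneg (ratr q)) = phi (nneg (ratr q)) &
        forall C : set (Rplus R), compact C ->
          {uniform C, (fun k => f (i (sigma k))) @ \oo --> phi0}].
Proof.
move=> FG.
(* Enumeration of the rational points; numbers that code no rational give 0. *)
pose r j : Rplus R := nneg (ratr (odflt 0 (@unpickle rat j))).
pose P k (i : I) := [/\ G k i, K (f i) & forall j, (j <= k)%N ->
  ball (phi (r j)) k.+1%:R^-1 (f i (r j))].
have exP k : exists i, P k i.
  apply: (@filter_ex _ F); near=> i; split.
  - by near: i; exact: FG.
  - by near: i.
  - move=> j jk; have {}jk : (j < k.+1)%N by [].
    (* Passing to ordinals makes this a finite intersection of members of [F]. *)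
    rewrite -[j]/(\val (Ordinal jk)); move: (Ordinal jk).
    near: i; apply: filter_forall => j'.
    by move/cvg_ballP : (@f_cvg (r j')); apply; rewrite invr_gt0 ltr0Sn.
have [i Pi] := choice exP.
have rcvg j : f (i k) (r j) @[k --> \oo] --> phi (r j).
  apply/cvg_ballP => e e0; near=> k.
  have [_ _ /(_ j)] := Pi k; rewrite (_ : (j <= k)%N); last first.
    by near: k; exact: nbhs_infty_ge.
  move=> /(_ isT); apply: le_ball; apply/ltW; near: k.
  exact: near_infty_natSinv_lt (PosNum e0).
have rq q : r (pickle q) = nneg (ratr q) by rewrite /r pickleK.
(* Since 0 is a rational point, the initial values converge, as (K4) requires. *)
have r0 : r (pickle (0 : rat)) = nneg 0 by rewrite rq rmorph0.
have [|k|sigma [phi0 [incr Kphi0 ucvg]]] :=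
  hK4 (phi := fun k => f (i k)) (x0 := phi (nneg 0)).
- by move=> k; have [] := Pi k.
- by rewrite -r0; exact: rcvg.
exists i, sigma, phi0; split=> //; first by move=> k; have [] := Pi k.
move=> q; rewrite -rq.
have := ucvg _ (@compact_set1 _ (r (pickle q))).
rewrite uniform_set1 => c1.
have c2 := cvg_subseq incr (rcvg (pickle q)).
exact: (cvg_unique (@metric_hausdorff R X) c1 c2).
Unshelve. all: by end_near. Qed.

Lemma pointwise_limit_K : K phi.
Proof.
have [_ [_ [phi0 [_ _ Kphi0 phi0q _]]]] :=
  K4_extraction (G := fun=> setT) (fun=> filterT).
suff -> : phi = phi0 by [].
(* An extraction only identifies its limit on the rationals; a second one, made
   to converge at [t] too, has the same limit by density. *)
apply/funext => t.
have [k|i [sigma [phi1 [Gi incr Kphi1 phi1q ucvg]]]] :=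
  K4_extraction (G := fun k => [set i | ball (phi t) k.+1%:R^-1 (f i t)]).
  by move/cvg_ballP : (@f_cvg t); apply; rewrite invr_gt0 ltr0Sn.
have -> : phi0 = phi1.
  apply: continuous_eq_nneg_rat; [exact: KC|exact: KC|].
  by move=> q; rewrite phi0q phi1q.
have := ucvg _ (@compact_set1 _ t); rewrite uniform_set1 => c1.
have c2 := cvg_subseq incr (cvg_ball_inv Gi).
exact: (cvg_unique (@metric_hausdorff R X) c2 c1).
Qed.

(** If this failed for some [e], the ultrafilter would contain the set of indices where the values
    are not [e]-close. Extracting a sequence from that set contradicts the uniform convergence given
    by (K4) on a compact set containing the times. *)
Lemma pointwise_limit_continuous (u : I -> Rplus R) (T : Rplus R) :
  UltraFilter F ->
  u i @[i --> F] --> T -> f i (u i) @[i --> F] --> phi T.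
Proof.
move=> UF uT; apply/cvg_ballP => e e0.
have [//|Fe] := in_ultra_setVsetC [set i | ball (phi T) e (f i (u i))] UF.
have vT : (\val (u i) : R) @[i --> F] --> (\val T : R).
  exact: (continuous_cvg _ (@val_continuous R T) uT).
pose G k := ~` [set i | ball (phi T) e (f i (u i))] `&`
  [set i | ball (\val T : R) k.+1%:R^-1 (\val (u i) : R)].
have [k|i [sigma [phi1 [Gi incr Kphi1 phi1q ucvg]]]] := K4_extraction (G := G).
  apply: filterI => //.
  by move/cvg_ballP : vT; apply; rewrite invr_gt0 ltr0Sn.
have phi1E : phi1 = phi.
  apply: continuous_eq_nneg_rat; [exact: KC|exact/KC/pointwise_limit_K|].
  by [].
rewrite {}phi1E {phi1q Kphi1} in ucvg.
pose v k := u (i (sigma k)).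
have vcvg : v k @[k --> \oo] --> T.
  have c : (\val (u (i k)) : R) @[k --> \oo] --> (\val T : R).
    by apply: cvg_ball_inv => k; have [] := Gi k.
  rewrite -[T]nnegK; apply: (@cvg_trans _ (nneg (\val (v k)) @[k --> \oo])).
    by apply: near_eq_cvg; apply: nearW => k /=; rewrite nnegK.
  exact: (continuous_cvg _ (@nneg_continuous R _) (cvg_subseq incr c)).
(* The margin 1 suffices: each [v k] is within the inverse of a positive integer of [T]. *)
pose C := @nneg R @` `[0, \val T + 1].
have cC : compact C.
  apply: continuous_compact; last exact: segment_compact.
  exact/continuous_subspaceT/nneg_continuous.
have e20 : 0 < e / 2 by rewrite divr_gt0.
have vC : \forall k \near \oo, C (v k).
  near=> k; exists (\val (v k)); last exact: nnegK.
  rewrite /= in_itv /= Rplus_ge0 /=.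
  have [_] := Gi (sigma k); rewrite /ball /= -/(v k).
  rewrite ltr_distlC => /andP[_ /ltW/le_trans]; apply.
  by rewrite lerD2l invf_le1 // ler1n.
have unear : \forall k \near \oo,
    forall s, C s -> ball (phi s) (e / 2) (f (i (sigma k)) s).
  have /= := ucvg C cC [set h | forall s, C s -> ball (phi s) (e / 2) (h s)].
  apply; apply/uniform_nbhs.
  exists [set xy | ball xy.1 (e / 2) xy.2]; split => //.
  exact: entourage_ball (PosNum e20).
have pnear : \forall k \near \oo, ball (phi T) (e / 2) (phi (v k)).
  have : phi (v k) @[k --> \oo] --> phi T.
    have cphi : continuous phi := KC pointwise_limit_K.
    exact: (@continuous_cvg _ _ _ \oo _ v phi T (cphi T) vcvg).
  by move/cvg_ballP/(_ _ e20).
have [k [Ck uk pk]] : exists k, [/\ C (v k),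
    forall s, C s -> ball (phi s) (e / 2) (f (i (sigma k)) s) &
    ball (phi T) (e / 2) (phi (v k))].
  by apply: (@filter_ex _ \oo); near=> k; split; near: k.
have [+ _] := Gi (sigma k); case => /=; rewrite (splitr e).
exact: ball_triangle pk (uk _ Ck).
Unshelve. all: by end_near. Qed.

End pointwise.

Lemma shifted_limit_continuous (I : Type) (F : set_system I) (g : R -> X)
    (u d : I -> R) (psi : R -> X) (T : R) :
  UltraFilter F ->
  (\forall i \near F, K (sigL (half_line R) (fun t => g (u i + t)))) ->
  (forall t, g (u i + t) @[i --> F] --> psi t) ->
  (forall i, 0 <= d i) -> 0 <= T -> d i @[i --> F] --> T ->
  g (u i + d i) @[i --> F] --> psi T.
Proof.
move=> UF Kg gpsi d0 T0 dT; have PF : ProperFilter F by exact: ultra_proper.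
pose f i := sigL (half_line R) (fun t => g (u i + t)).
have fpsi r : f i r @[i --> F] --> sigL (half_line R) psi r.
  exact: (gpsi (\val r)).
have dT' : nneg (d i) @[i --> F] --> nneg T.
  exact: (continuous_cvg _ (@nneg_continuous R _) dT).
have := pointwise_limit_continuous Kg fpsi UF dT'.
move=> /(_ PF); rewrite /f /sigL /comp set_valE val_nneg //.
suff -> : (fun i => g (u i + \val (nneg (d i)))) = (fun i => g (u i + d i)).
  by [].
by apply/funext => i; rewrite val_nneg.
Qed.

End limits_of_trajectories.

(** * Ultrafilters, shrinking of neighbourhoods, and exit times *)

Lemma compact_ultra_cvg (X : topologicalType) (I : Type) (F : set_system I)
    (C : set X) (g : I -> X) :
  UltraFilter F -> compact C -> (\forall i \near F, C (g i)) ->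
  exists2 x, C x & g i @[i --> F] --> x.
Proof.
move=> UF cC FC; have FF : ProperFilter F by exact: ultra_proper.
have [x [Cx clx]] := cC (g @ F) _ FC.
exists x => // B nB; have [//|FnB] := in_ultra_setVsetC (g @^-1` B) UF.
by have [z [nz Bz]] := clx (~` B) B FnB nB.
Qed.

Lemma cvg_shift0 (R : realType) (X : topologicalType) (I : Type)
    (F : set_system I) (g : R -> X) (u : I -> R) (x : X) :
  g (u i + 0) @[i --> F] --> x -> g (u i) @[i --> F] --> x.
Proof.
suff -> : (fun i => g (u i + 0)) = (fun i => g (u i)) by [].
by apply/funext => i; rewrite addr0.
Qed.

(** Normality is applied to [N] with [z] removed, still a neighbourhood of [M] because points are
    closed. *)
Lemma closed_shrink (R : realType) (X : metricType R) (M N : set X) (z : X) :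
  closed M -> set_nbhs M N -> ~ M z ->
  exists U, [/\ open U, M `<=` U, closure U `<=` N & ~ closure U z].
Proof.
move=> cM MN nMz.
have [V MV clV] : filter_from (set_nbhs M) closure (N `&` ~` [set z]).
  apply: (@pseudometric_normal R X M cM) => x Mx.
  apply: filterI; first exact: MN.
  apply: open_nbhs_nbhs; split; last by move=> /= xz; apply: nMz; rewrite -xz.
  apply: closed_openC; apply: compact_closed (@compact_set1 _ z).
  exact: metric_hausdorff.
have clV' : closure V° `<=` closure V.
  by apply: closure_subset; exact: interior_subset.
exists V°; split; first exact: open_interior.
- by move=> x Mx; exact: MV.
- by move=> x /clV' /clV [].
- by move=> /clV' /clV [_]; apply.
Qed.

(** If some set [A <= d i] is not in the ultrafilter, then [d] is below [A] along it, and the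
    segment from 0 to [A] is compact. *)
Lemma ultra_cvgry_or_cvg (R : realType) (I : Type) (F : set_system I)
    (d : I -> R) :
  UltraFilter F -> (forall i, 0 <= d i) ->
  d i @[i --> F] --> +oo \/ exists2 T : R, 0 <= T & d i @[i --> F] --> T.
Proof.
move=> UF d0; have FF : ProperFilter F by exact: ultra_proper.
have [|] := pselect (forall A, F [set i | A <= d i]).
  by move=> dA; left; apply/cvgryPge.
move=> /existsNP[A nA]; right.
have [//|FA] := in_ultra_setVsetC [set i | A <= d i] UF.
have [|T] := @compact_ultra_cvg _ _ F `[0, A]%classic d UF
  (@segment_compact _ _ _).
  apply: filterS FA => i /= /negP; rewrite -ltNge => /ltW dA.
  by rewrite in_itv /= d0.
by rewrite /= in_itv /= => /andP[T0 _] dT; exists T.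
Qed.

(** The time is the infimum of the times after [a] spent outside [U]; it is attained because [U] is
    open and [g] continuous. *)
Lemma first_exit (R : realType) (X : topologicalType) (g : R -> X) (U : set X)
    (a b : R) :
  continuous g -> open U -> a <= b -> ~ U (g b) ->
  exists s, [/\ a <= s, s <= b, ~ U (g s) & forall r, a <= r < s -> U (g r)].
Proof.
move=> cg oU ab nUb; pose E := [set r | a <= r /\ ~ U (g r)].
have lbE : lbound E a by move=> r [].
have iE : has_inf E by split; [exists b|exists a].
exists (inf E); split.
- by apply: lb_le_inf => //; exists b.
- by apply: ge_inf => //; exists a.
- move=> Us.
  have : nbhs (inf E) (g @^-1` U) by apply: cg; exact: open_nbhs_nbhs.
  move=> /nbhs_ballP[e /= e0 eU].
  have [r [ar nUr] rs] := inf_adherent e0 iE.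
  have ir : inf E <= r by apply: ge_inf => //; exists a.
  apply: nUr; apply: eU; rewrite /ball /= ltr_distlC rs andbT.
  by rewrite ltrBlDr (le_lt_trans ir) // ltrDl.
- move=> r /andP[ar rs]; apply: contrapT => nUr.
  have : inf E <= r by apply: ge_inf => //; exists a.
  by rewrite leNgt rs.
Qed.

(** This is [first_exit] with time reversed. *)
Lemma last_entrance (R : realType) (X : topologicalType) (g : R -> X)
    (U : set X) (a b : R) :
  continuous g -> open U -> a <= b -> ~ U (g a) ->
  exists s, [/\ a <= s, s <= b, ~ U (g s) & forall r, s < r <= b -> U (g r)].
Proof.
move=> cg oU ab nUa.
have cgN : continuous (fun r => g (- r)).
  by move=> r; apply: continuous_comp; [exact: oppr_continuous|exact: cg].
have [| |s [bs sa nUs Us]] := @first_exit _ _ _ U (- b) (- a) cgN oU.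
- by rewrite lerN2.
- by rewrite opprK.
exists (- s); split; [by rewrite lerNr|by rewrite lerNl|by []|].
by move=> r /andP[sr rb]; rewrite -[r]opprK; apply: Us; rewrite lerN2 rb ltrNl.
Qed.

(** * Limit sets at either end of the line *)

Section limit_sets.
Context {R : realType} {X : metricType R}.

(* [limit_set -oo g] is [alpha g] by definition. *)
Definition limit_set (F : set_system R) (g : R -> X) : set X :=
  [set y | exists2 t : nat -> R,
     t n @[n --> \oo] --> F & g (t n) @[n --> \oo] --> y].

Lemma omega_sigL (g : R -> X) :
  omega (sigL (half_line R) g) = limit_set +oo g.
Proof.
apply/seteqP; split=> y [t too gy].
  by exists (fun n => \val (t n)).
(* The first times may be negative, where [nneg] changes them; the tail is unaffected. *)
have t0 : \forall n \near \oo, 0 <= t n by exact: (cvgry_ge too).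
have tE : \forall n \near \oo, t n = \val (nneg (t n)).
  by apply: filterS t0 => n t0; rewrite val_nneg.
exists (fun n => nneg (t n)).
  by apply: cvg_trans too; exact: near_eq_cvg.
apply: cvg_trans gy; apply: near_eq_cvg.
by apply: filterS tE => n {1}->.
Qed.

Lemma limit_set_sub (F : set_system R) (g : R -> X) (D : set X) :
  closed D -> (\forall s \near F, D (g s)) -> limit_set F g `<=` D.
Proof.
move=> cD FD y [t tF gy].
apply: (@closed_cvg _ _ \oo _ (fun n => g (t n)) D cD _ y gy).
exact: tF FD.
Qed.

Lemma limit_set_visit (F : set_system R) (g : R -> X) (y : X) (W : set X)
    (P : set R) :
  limit_set F g y -> nbhs y W -> F P -> exists2 s, P s & W (g s).
Proof.
move=> [t tF gy] yW FP.
have [n [Pn Wn]] : exists n, P (t n) /\ W (g (t n)).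
  apply: (@filter_ex _ \oo); apply: filterI; [exact: tF FP|exact: gy yW].
by exists (t n).
Qed.

Section at_infinity.
Variable F : set_system R.
Hypothesis F_infty : F = +oo \/ F = -oo.

Lemma infty_proper : ProperFilter F.
Proof. by case: F_infty => ->; exact: _. Qed.

Lemma infty_shift (I : Type) (G : set_system I) (t : I -> R) (h : R) :
  ProperFilter G -> t i @[i --> G] --> F -> (t i + h) @[i --> G] --> F.
Proof.
move=> GG; case: F_infty => -> tF.
  by apply/cvgryPge => A; apply: filterS (cvgry_ge tF (A - h)) => i;
    rewrite lerBlDr.
by apply/cvgrNyPle => A; apply: filterS (cvgrNy_le tF (A - h)) => i;
  rewrite lerBrDr.
Qed.

(** Limit sets are defined by sequences; this countable family allows [limit_set_cvg] to pick one
    out of a convergence along any proper filter. *)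
Lemma infty_sequence : exists V : nat -> set R, (forall k, F (V k)) /\
  forall t : nat -> R, (forall k, V k (t k)) -> t k @[k --> \oo] --> F.
Proof.
case: F_infty => ->.
  exists (fun k => [set s | k%:R <= s]); split => [k|t tV].
    exact: nbhs_pinfty_ge.
  apply/cvgryPge => A; near=> k; apply: le_trans (tV k); near: k.
  exact: nbhs_infty_ger.
exists (fun k => [set s | s <= - k%:R]); split => [k|t tV].
  exact: nbhs_ninfty_le.
apply/cvgrNyPle => A; near=> k; apply: le_trans (tV k) _.
rewrite lerNl; near: k; exact: nbhs_infty_ger.
Unshelve. all: by end_near. Qed.

Lemma limit_set_cvg (g : R -> X) (I : Type) (G : set_system I) (t : I -> R)
    (y : X) :
  ProperFilter G -> t i @[i --> G] --> F -> g (t i) @[i --> G] --> y ->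
  limit_set F g y.
Proof.
move=> GG tF gy; have [V [FV VF]] := infty_sequence.
have exi k : exists i, V k (t i) /\ ball y k.+1%:R^-1 (g (t i)).
  apply: (@filter_ex _ G); apply: filterI; first exact: tF (FV k).
  by move/cvg_ballP : gy; apply; rewrite invr_gt0 ltr0Sn.
have [i iP] := choice exi; exists (fun k => t (i k)).
  by apply: VF => k; have [] := iP k.
by apply: cvg_ball_inv => k; have [] := iP k.
Qed.

Lemma limit_set_neq0 (g : R -> X) (C : set X) :
  compact C -> (\forall s \near F, C (g s)) -> limit_set F g !=set0.
Proof.
move=> cC FC; have PF := infty_proper.
have [G [UG FG]] := ultraFilterLemma PF.
have [y _ gy] := compact_ultra_cvg UG cC (FG _ FC).
by exists y; apply: (limit_set_cvg (t := id) (@ultra_proper _ _ UG)).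
Qed.

Variable K : set (Rplus R -> X).
Hypothesis KC : forall f, K f -> continuous f.
Hypothesis hK4 : K4 K.

Section limits_at_infinity.
Variables (g : R -> X) (C : set X).
Hypothesis cC : compact C.
Hypothesis gC : \forall s \near F, C (g s).
Hypothesis gK : \forall s \near F, K (sigL (half_line R) (fun t => g (s + t))).

(** For each fixed [t] the times [s i + t] still tend to [F], so compactness of [C] gives a limit,
    which belongs to the limit set. *)
Lemma limit_trajectory (I : Type) (G : set_system I) (s : I -> R) :
  UltraFilter G -> s i @[i --> G] --> F ->
  exists phi : R -> X, [/\ complete_trajectory K phi,
    forall t, g (s i + t) @[i --> G] --> phi t &
    forall t, limit_set F g (phi t)].
Proof.
move=> UG sF; have PG : ProperFilter G by exact: ultra_proper.
have exphi t : exists x : X, g (s i + t) @[i --> G] --> x.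
  have [|x _ xP] := compact_ultra_cvg (g := fun i => g (s i + t)) UG cC.
    exact: (infty_shift t PG sF gC).
  by exists x.
have [phi phiP] := choice exphi; exists phi; split=> // [h|t].
  (* The restriction of [phi (t + h)] is the limit of the translates of [g] by [s i + h], which lie
     in [K] along [G], even when [h] is negative. *)
  apply: (pointwise_limit_K KC hK4 (F := G)
    (f := fun i => sigL (half_line R) (fun t => g (s i + (t + h))))).
    have near_K : \forall i \near G,
        K (sigL (half_line R) (fun t => g (s i + h + t))).
      exact: (infty_shift h PG sF gK).
    apply: filterS near_K => i; congr K; apply/funext => t /=.
    by rewrite -addrA [h + _]addrC.
  by move=> t /=; exact: phiP.
exact: limit_set_cvg PG (infty_shift t PG sF) (phiP t).
Qed.

Lemma limit_set_quasi_invariant : quasi_invariant K (limit_set F g).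
Proof.
move=> y [t tF gy]; have [G [UG ooG]] := ultraFilterLemma (@eventually_filter).
have PG : ProperFilter G by exact: ultra_proper.
have tG : t n @[n --> G] --> F by move=> A /tF; exact: ooG.
have [phi [phiK phiP phiL]] := limit_trajectory UG tG.
exists phi; split => //.
apply: (cvg_unique (@metric_hausdorff R X) (cvg_shift0 (phiP 0))).
by move=> A /gy; exact: ooG.
Qed.

Lemma limit_set_sub_maximal (O M D : set X) :
  maximal_quasi_invariant_in K O M -> closed D -> D `<=` O ->
  (\forall s \near F, D (g s)) -> limit_set F g `<=` M.
Proof.
move=> [_ _ maxM] cD DO FD; apply: maxM; first exact: limit_set_quasi_invariant.
by apply: subset_trans DO; exact: limit_set_sub.
Qed.

End limits_at_infinity.
End at_infinity.
End limit_sets.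

(** * Gluing complete trajectories *)

Section gluing.
Context {R : realType} {X : metricType R} (K : set (Rplus R -> X)).

Lemma complete_trajectory_shift (phi : R -> X) (c : R) :
  complete_trajectory K phi -> complete_trajectory K (fun t => phi (t + c)).
Proof.
move=> phiK h; have := phiK (h + c); congr K.
by apply/funext => t /=; rewrite addrA.
Qed.

Lemma complete_trajectory_tail (phi : R -> X) :
  complete_trajectory K phi -> K (sigL (half_line R) phi).
Proof.
by move=> /(_ 0); congr K; apply/funext => t /=; rewrite addr0.
Qed.

Definition glue (phi psi : R -> X) : R -> X :=
  fun t => if t <= 0 then phi t else psi t.

Lemma glue_ge0 (phi psi : R -> X) (t : R) :
  phi 0 = psi 0 -> 0 <= t -> glue phi psi t = psi t.
Proof.
rewrite /glue => phipsi t0; case: ifPn => // t0'.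
by have -> : t = 0 by apply/le_anti; rewrite t0 t0'.
Qed.

Lemma complete_trajectory_glue (phi psi : R -> X) :
  K3 K -> complete_trajectory K phi -> complete_trajectory K psi ->
  phi 0 = psi 0 -> complete_trajectory K (glue phi psi).
Proof.
move=> hK3 phiK psiK phipsi h; have [h0|h0] := leP 0 h.
  have := psiK h; congr K; apply/funext => t /=.
  by rewrite glue_ge0 // addr_ge0 // Rplus_ge0.
have Nh0 : 0 <= - h by rewrite oppr_ge0 ltW.
(* After the shift by [h < 0] the junction sits at time [- h > 0], where (K3) concatenates the
   shifted [phi] with the tail of [psi]. *)
have := @hK3 _ _ (nneg (- h)) (phiK h) (complete_trajectory_tail psiK).
rewrite val_nneg // oppr_gt0 => /(_ h0); rewrite /sigL /= set_valE.
rewrite !val_nneg // addNr => /(_ (esym phipsi)); congr K.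
apply/funext => t; have tE : (\val t <= - h) = (\val t + h <= 0).
  by rewrite -lerBrDr sub0r.
rewrite /concat /glue val_nneg // tE /=; case: ifPn => //.
by rewrite -ltNge opprK => th; rewrite max_r // ltW.
Qed.

End gluing.

(** * Limit trajectories near the isolated set *)

Section near_isolated_set.
Context {R : realType} {X : metricType R} (K : set (Rplus R -> X)).
Hypothesis KC : forall f, K f -> continuous f.
Hypothesis hK3 : K3 K.
Hypothesis hK4 : K4 K.
Variables (g : R -> X) (C M N U : set X) (y z : X).
Hypothesis g_cont : continuous g.
Hypothesis cC : compact C.
Hypothesis g_C : \forall s \near +oo, C (g s).
Hypothesis g_K :
  \forall s \near +oo, K (sigL (half_line R) (fun t => g (s + t))).
Hypothesis cM : compact M.
Hypothesis maxM : maximal_quasi_invariant_in K N M.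
Hypothesis oU : open U.
Hypothesis MU : M `<=` U.
Hypothesis clUN : closure U `<=` N.
Hypothesis lim_y : limit_set +oo g y.
Hypothesis My : M y.
Hypothesis lim_z : limit_set +oo g z.
Hypothesis nclUz : ~ closure U z.

Let infty_y : (+oo : set_system R) = +oo \/ (+oo : set_system R) = -oo.
Proof. by left. Qed.

Let infty_Ny : (-oo : set_system R) = +oo \/ (-oo : set_system R) = -oo.
Proof. by right. Qed.

Let visit (a : R) n : exists2 t, a <= t & ball y n.+1%:R^-1 (g t).
Proof.
apply: (limit_set_visit (F := +oo) lim_y).
  by apply: nbhsx_ballx; rewrite invr_gt0 ltr0Sn.
exact: nbhs_pinfty_ge (num_real _).
Qed.

Let leave (a : R) : exists2 t, a <= t & ~ U (g t).
Proof.
have [||t at_ nUt] := limit_set_visit (W := ~` closure U)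
    (P := [set t | a <= t]) lim_z.
- by apply: open_nbhs_nbhs; split=> //; exact/closed_openC/closed_closure.
- exact: nbhs_pinfty_ge (num_real _).
- by exists t => // /subset_closure.
Qed.

Let trajectory_in_M :
  exists psi, [/\ complete_trajectory K psi, psi 0 = y & forall t, M (psi t)].
Proof. by case: maxM => qM _ _; exact: qM. Qed.

Let ultra_cvgry (G : set_system nat) (u : nat -> R) :
  ProperFilter G -> \oo `<=` G -> (forall n, n%:R <= u n) ->
  u n @[n --> G] --> +oo.
Proof.
move=> PG ooG un; apply/cvgryPge => A; apply: ooG; near=> n.
by apply: le_trans (un n); near: n; exact: nbhs_infty_ger.
Unshelve. all: by end_near. Qed.

Let ultra_cvg_y (G : set_system nat) (u : nat -> R) : \oo `<=` G ->
  (forall n, ball y n.+1%:R^-1 (g (u n))) -> g (u n) @[n --> G] --> y.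
Proof. by move=> ooG /cvg_ball_inv uy A /uy; exact: ooG. Qed.

Let limit_outside (G : set_system nat) (u : nat -> R) x : ProperFilter G ->
  (forall n, ~ U (g (u n))) -> g (u n) @[n --> G] --> x -> ~ U x.
Proof.
move=> PG nUu; apply: (@closed_cvg _ _ G _ (fun n => g (u n)) (~` U)).
  exact: open_closedC.
exact: nearW.
Qed.

(** For transit times tending to infinity: [psi] lives in the limit set of [g], hence in the compact
    [C], and maximality of [M] in [N] applies to its own limit set. *)
Let limit_set_in_closure (F : set_system R) (psi : R -> X) :
  F = +oo \/ F = -oo -> complete_trajectory K psi ->
  (forall t, limit_set +oo g (psi t)) ->
  (\forall t \near F, closure U (psi t)) ->
  limit_set F psi !=set0 /\ limit_set F psi `<=` M.
Proof.
move=> FE psiK psi_lim psiU.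
have FF := infty_proper FE.
have clC : closed C by exact: compact_closed (@metric_hausdorff R X) cC.
have psi_C : \forall t \near F, C (psi t).
  by apply: nearW => t; exact: limit_set_sub clC g_C _ (psi_lim t).
split; first exact: (limit_set_neq0 FE cC psi_C).
apply: (limit_set_sub_maximal FE KC hK4 cC psi_C _ maxM _ clUN psiU).
  apply: nearW => t; have := psiK t; congr K.
  by apply/funext => s /=; rewrite addrC.
exact: closed_closure.
Qed.

(** For convergent transit times, where the glued trajectory is eventually in [M]. *)
Let limit_set_in_M (F : set_system R) (psi : R -> X) :
  F = +oo \/ F = -oo -> (\forall t \near F, M (psi t)) ->
  limit_set F psi !=set0 /\ limit_set F psi `<=` M.
Proof.
move=> FE psiM; split; first exact: (limit_set_neq0 FE cM psiM).
by apply: limit_set_sub psiM; exact: compact_closed (@metric_hausdorff R X) cM.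
Qed.

(** Here the translates by the times [s n] outside [U] serve both alternatives: their limit either
    stays in [closure U] at positive times or reaches [y] at time [T]. *)
Lemma exists_stable_trajectory : exists psi : R -> X,
  [/\ complete_trajectory K psi, limit_set +oo g (psi 0), ~ M (psi 0),
      limit_set +oo psi !=set0 /\ limit_set +oo psi `<=` M &
      forall t, (limit_set +oo g `|` M) (psi t)].
Proof.
have [phiM [phiMK phiMy phiM_M]] := trajectory_in_M.
have [G [UG ooG]] := ultraFilterLemma (@eventually_filter).
have PG : ProperFilter G by exact: ultra_proper.
have exst n : exists st : R * R, [/\ n%:R <= st.1, st.1 <= st.2,
    ball y n.+1%:R^-1 (g st.2), ~ U (g st.1) &
    forall r, st.1 < r <= st.2 -> U (g r)].
  (* Choosing the time [a] outside [U] beyond [n], before the visit [t], forces the last time [s]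
     outside [U] beyond [n] too. *)
  have [a na nUa] := leave n%:R; have [t at_ ty] := visit a n.
  have [s [as_ st nUs Us]] := last_entrance g_cont oU at_ nUa.
  by exists (s, t); split => //=; exact: le_trans na as_.
have [st /all_and5[s_ge s_le ty nUs Us]] := choice exst.
pose s n := (st n).1; pose t n := (st n).2.
have soo : s n @[n --> G] --> +oo by exact: ultra_cvgry PG ooG s_ge.
have [psi [psiK psiP psi_omega]] :=
  limit_trajectory infty_y KC hK4 cC g_C g_K UG soo.
have nU0 : ~ U (psi 0) by apply: limit_outside PG nUs (cvg_shift0 (psiP 0)).
have [doo|[T T0 dT]] := ultra_cvgry_or_cvg (d := fun n => t n - s n) UG
  (fun n => etrans (subr_ge0 _ _) (s_le n)).
  exists psi; split=> //.
  - by move=> /MU.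
  - apply: limit_set_in_closure => //; near=> r.
    (* Strict, since [g (s n)] itself is outside [U]. *)
    have r0 : 0 < r by near: r; exact: nbhs_pinfty_gt (num_real _).
    apply: (@closed_cvg _ _ G _ (fun n => g (s n + r)) (closure U)).
    + exact: closed_closure.
    + apply: filterS (cvgry_ge doo r) => n rd; apply: subset_closure.
      by apply: (Us n); rewrite -/(s n) -/(t n) ltrDl r0 /= addrC -lerBrDr.
    + exact: psiP.
  - by move=> r; left.
have psiT : psi T = phiM 0.
  rewrite phiMy.
  apply: (cvg_unique (@metric_hausdorff R X) _ (ultra_cvg_y ooG ty)).
  have := shifted_limit_continuous KC hK4 (d := fun n => t n - s n) UG
    (soo _ g_K) psiP _ T0 dT.
  have -> : (fun n => g (s n + (t n - s n))) = (fun n => g (t n)).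
    by apply/funext => n; rewrite addrC subrK.
  by apply => // n; rewrite subr_ge0; exact: s_le.
(* From time [T] on, [psi] is replaced by the trajectory through [y] inside [M]; the final shift by
   [- T] makes it start at [psi 0], outside [U]. *)
pose Phi := glue (fun r => psi (r + T)) phiM.
have glue0 : psi (0 + T) = phiM 0 by rewrite add0r.
have PhiK : complete_trajectory K Phi.
  by apply: complete_trajectory_glue => //; exact: complete_trajectory_shift.
have Phi0 : Phi (0 - T) = psi 0.
  by rewrite /Phi /glue sub0r oppr_le0 T0 addNr.
exists (fun r => Phi (r - T)); rewrite Phi0; split => //.
- exact: complete_trajectory_shift.
- by move=> /MU.
- apply: limit_set_in_M => //; near=> r.
  rewrite /Phi glue_ge0 //; rewrite subr_ge0; near: r.
  exact: nbhs_pinfty_ge (num_real _).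
- by move=> r; rewrite /Phi /glue; case: ifPn => _; [left|right].
Unshelve. all: by end_near. Qed.

Lemma exists_unstable_trajectory : exists psi : R -> X,
  [/\ complete_trajectory K psi, limit_set +oo g (psi 0), ~ M (psi 0),
      limit_set -oo psi !=set0 /\ limit_set -oo psi `<=` M &
      forall t, (limit_set +oo g `|` M) (psi t)].
Proof.
have [phiM [phiMK phiMy phiM_M]] := trajectory_in_M.
have [G [UG ooG]] := ultraFilterLemma (@eventually_filter).
have PG : ProperFilter G by exact: ultra_proper.
have exst n : exists st : R * R, [/\ n%:R <= st.2, st.2 <= st.1,
    ball y n.+1%:R^-1 (g st.2), ~ U (g st.1) &
    forall r, st.2 <= r < st.1 -> U (g r)].
  have [t nt ty] := visit n%:R n; have [b tb nUb] := leave t.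
  have [s [ts sb nUs Us]] := first_exit g_cont oU tb nUb.
  by exists (s, t).
have [st /all_and5[t_ge t_le ty nUs Us]] := choice exst.
pose s n := (st n).1; pose t n := (st n).2.
have too : t n @[n --> G] --> +oo by exact: ultra_cvgry PG ooG t_ge.
have soo : s n @[n --> G] --> +oo.
  by apply: (ultra_cvgry PG ooG) => n; exact: le_trans (t_ge n) (t_le n).
have [doo|[T T0 dT]] := ultra_cvgry_or_cvg (d := fun n => s n - t n) UG
  (fun n => etrans (subr_ge0 _ _) (t_le n)).
  have [psi [psiK psiP psi_omega]] :=
    limit_trajectory infty_y KC hK4 cC g_C g_K UG soo.
  have nU0 : ~ U (psi 0) by apply: limit_outside PG nUs (cvg_shift0 (psiP 0)).
  exists psi; split=> //.
  - by move=> /MU.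
  - apply: limit_set_in_closure => //; near=> r.
    have r0 : r < 0 by near: r; exact: nbhs_ninfty_lt (num_real _).
    apply: (@closed_cvg _ _ G _ (fun n => g (s n + r)) (closure U)).
    + exact: closed_closure.
    + apply: filterS (cvgry_ge doo (- r)) => n rd; apply: subset_closure.
      apply: (Us n); rewrite -/(s n) -/(t n) gtrDl r0 andbT.
      by rewrite -lerBlDr addrC -lerBrDr.
    + exact: psiP.
  - by move=> r; left.
have [psi [psiK psiP psi_omega]] :=
  limit_trajectory infty_y KC hK4 cC g_C g_K UG too.
have psi0 : phiM 0 = psi 0.
  rewrite phiMy.
  exact: (cvg_unique (@metric_hausdorff R X) (ultra_cvg_y ooG ty)
    (cvg_shift0 (psiP 0))).
(* [psi T] is the limit of the exit points [g (s n)], and the complement of [U] is closed. *)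
have nUT : ~ U (psi T).
  apply: limit_outside PG nUs _.
  have := shifted_limit_continuous KC hK4 (d := fun n => s n - t n) UG
    (too _ g_K) psiP _ T0 dT.
  have -> : (fun n => g (t n + (s n - t n))) = (fun n => g (s n)).
    by apply/funext => n; rewrite addrC subrK.
  by apply => // n; rewrite subr_ge0; exact: t_le.
(* The past of [psi] is replaced by a trajectory inside [M]; after the shift by [T] the value at 0
   is [psi T] and all times up to [- T] are spent in [M]. *)
pose Phi := glue phiM psi.
have PhiK : complete_trajectory K Phi by exact: complete_trajectory_glue.
have Phi0 : Phi (0 + T) = psi T by rewrite add0r /Phi glue_ge0.
exists (fun r => Phi (r + T)); rewrite Phi0; split => //.
- exact: complete_trajectory_shift.
- by move=> /MU.
- apply: limit_set_in_M => //; near=> r.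
  rewrite /Phi /glue ifT // -lerBrDr sub0r; near: r.
  exact: nbhs_ninfty_le (num_real _).
- by move=> r; rewrite /Phi /glue; case: ifPn => _; [right|left].
Unshelve. all: by end_near. Qed.

End near_isolated_set.

(** * From limit trajectories to witnesses for the weakly stable and unstable sets *)

Theorem theorem18 (R : realType) (X : metricType R)
    (hX : complete_space X)
    (K : set (Rplus R -> X))
    (hKC : forall f, K f -> continuous f)
    (hK1 : K1 K) (hK2 : K2 K) (hK3 : K3 K) (hK4 : K4 K)
    (phi : Rplus R -> X) (hphi : K phi)
    (hcompact : compact (closure (range phi)))
    (M : set X) (hMc : compact M)
    (hMq : quasi_invariant K M) (hMi : isolated_quasi_invariant K M)
    (hmeet : omega phi `&` M !=set0)
    (hnsub : ~ (omega phi `<=` M)) :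
  [/\ omega phi `&` (weakly_stable_set K M `\` M) !=set0,
      omega phi `&` (unstable_set K M `\` M) !=set0,
      exists (x : X) (psi : Rplus R -> X),
        [/\ (omega phi `&` (weakly_stable_set K M `\` M)) x,
            weakly_stable_witness K M x psi &
            forall t, (omega phi `|` M) (psi t)] &
      exists (x' : X) (psi' : R -> X),
        [/\ (omega phi `&` (unstable_set K M `\` M)) x',
            unstable_witness K M x' psi' &
            forall t, (omega phi `|` M) (psi' t)]].
Proof.
(* Extending [phi] by the constant [phi (nneg 0)] keeps it continuous; the translates of [g] lie in
   [K] for nonnegative shifts by (K2), which covers a neighbourhood of [+oo]. *)
pose g (t : R) := phi (nneg t).
have g_cont : continuous g.
  move=> t; apply: continuous_comp; first exact: nneg_continuous.
  exact: hKC hphi _.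
have g_K : \forall s \near +oo, K (sigL (half_line R) (fun t => g (s + t))).
  near=> s; have s0 : 0 <= s by near: s; exact: nbhs_pinfty_ge (num_real _).
  have := hK2 _ (nneg s) hphi; congr K; apply/funext => t.
  rewrite /translate /sigL /= /g -[Num.max 0 s]/(\val (nneg s)).
  by rewrite val_nneg // addrC.
pose C := closure (range phi).
have g_C : \forall s \near +oo, C (g s).
  by apply: nearW => s; apply: subset_closure; exists (nneg s).
have omegaE : omega phi = limit_set +oo g.
  have <- : sigL (half_line R) g = phi.
    by apply/funext => t; rewrite /sigL /= /g set_valE nnegK.
  exact: omega_sigL.
have [y [omega_y My]] := hmeet.
have [z [omega_z nMz]] := nonsubset hnsub.
have [N MN maxM] := hMi.
have closedM : closed M by exact: compact_closed (@metric_hausdorff R X) hMc.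
have [U [oU MU clUN nclUz]] := closed_shrink closedM MN nMz.
rewrite omegaE in omega_y omega_z *.
have stable := exists_stable_trajectory hKC hK3 hK4 g_cont hcompact g_C g_K hMc
  maxM oU MU clUN omega_y My omega_z nclUz.
have unstable := exists_unstable_trajectory hKC hK3 hK4 g_cont hcompact g_C g_K
  hMc maxM oU MU clUN omega_y My omega_z nclUz.
have stable_witness : exists (x : X) (psi : Rplus R -> X),
    [/\ (limit_set +oo g `&` (weakly_stable_set K M `\` M)) x,
        weakly_stable_witness K M x psi &
        forall t, (limit_set +oo g `|` M) (psi t)].
  have [psi [psiK psi0 nM0 [ne sub] psi_in]] := stable.
  (* The witness is the forward half of the complete trajectory, with the same limit set at
     [+oo]. *)
  have W : weakly_stable_witness K M (psi 0) (sigL (half_line R) psi).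
    split; [exact: complete_trajectory_tail| |by rewrite omega_sigL..].
    by rewrite /sigL /comp set_valE val_nneg.
  exists (psi 0), (sigL (half_line R) psi); split=> [|//|t]; last exact: psi_in.
  by split=> //; split=> //; exists (sigL (half_line R) psi).
have unstable_witness : exists (x' : X) (psi' : R -> X),
    [/\ (limit_set +oo g `&` (unstable_set K M `\` M)) x',
        unstable_witness K M x' psi' &
        forall t, (limit_set +oo g `|` M) (psi' t)].
  have [psi [psiK psi0 nM0 [ne sub] psi_in]] := unstable.
  exists (psi 0), psi; split=> //.
  by split=> //; split=> //; exists psi.
split=> //.
- by have [x [_ [xP _ _]]] := stable_witness; exists x.
- by have [x [_ [xP _ _]]] := unstable_witness; exists x.
Unshelve. all: by end_near. Qed.
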